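(* Let $X$ be a Banach space over $\mathbb{K}$ ($=\mathbb{R}$ or $\mathbb{C}$). If the pair $(X,\ell_\infty)$ has the BPBZp with a function $\eta$, then the pair $(X,c_0)$ has the BPBZp with the function $\varepsilon\mapsto\eta\left(\frac{\varepsilon}{2}\right)$ for $0<\varepsilon<1$.
   Context: $S_X$ is the unit sphere of a Banach space $X$, $X^*$ its topological dual, $\mathcal{L}(X,Y)$ the bounded linear operators from $X$ to $Y$. BPBZp with a function: the pair $(X,Y)$ of Banach spaces has the BPBZp with a function $\eta$ if for each $\varepsilon$ in the domain of $\eta$ (all $\varepsilon>0$, or $0<\varepsilon<1$ when so indicated; the property for small $\varepsilon$ suffices) one has $\eta(\varepsilon)>0$ and, whenever $T\in\mathcal{L}(X,Y)$ with $\|T\|=1$, $y_0^*\in S_{Y^*}$ and $x_0\in S_X$ satisfy $|y_0^*(Tx_0)|>1-\eta(\varepsilon)$, there exist $y_1^*\in S_{Y^*}$, $x_1\in S_X$ and $S\in\mathcal{L}(X,Y)$ with $\|S\|=|y_1^*(Sx_1)|=1$, $\|x_1-x_0\|<\varepsilon$, $\|y_1^*-y_0^*\|<\varepsilon$ and $\|S-T\|<\varepsilon$. *)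

(* Defs.v *)
From HB Require Import structures.
From mathcomp Require Import all_boot all_order all_algebra.
From mathcomp Require Import all_classical all_reals all_analysis.
From mathcomp Require Import complex.

Set Implicit Arguments.
Unset Strict Implicit.
Unset Printing Implicit Defensive.

Import Order.TTheory GRing.Theory Num.Theory.
Import numFieldNormedType.Exports.

Local Open Scope classical_set_scope.
Local Open Scope ring_scope.

Variant scalar_kind := RealScalars | ComplexScalars.

Definition scalars (R : realType) (k : scalar_kind) : numFieldType :=
  match k with
  | RealScalars => R
  | ComplexScalars => R[i]
  end.

Definition scalar_re (R : realType) (k : scalar_kind) : scalars R k -> R :=
  match k return scalars R k -> R with
  | RealScalars => fun x : R => x
  | ComplexScalars => fun x : R[i] => complex.Re x
  end.

Definition of_real (R : realType) (k : scalar_kind) : R -> scalars R k :=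
  match k return R -> scalars R k with
  | RealScalars => fun x : R => x
  | ComplexScalars => fun x : R => real_complex R x
  end.

Section scalar_theory.
Variables (R : realType) (k : scalar_kind).
Local Notation K := (scalars R k).

Lemma of_realK (r : R) : scalar_re (of_real k r) = r.
Proof. by case: k. Qed.

Lemma scalar_reK (x : K) : 0 <= x -> of_real k (scalar_re x) = x.
Proof.
case: k x => // -[a b].
by rewrite lecE /= => /andP[/eqP -> _].
Qed.

Lemma ler_of_real (r s : R) : (of_real k r <= of_real k s) = (r <= s).
Proof. by case: k => //=; rewrite lecR. Qed.

Lemma ltr_of_real (r s : R) : (of_real k r < of_real k s) = (r < s).
Proof. by case: k => //=; rewrite ltcR. Qed.

Lemma of_real0 : of_real k 0 = 0 :> K.
Proof. by case: k. Qed.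

Lemma of_real1 : of_real k 1 = 1 :> K.
Proof. by case: k. Qed.

Lemma of_realD (r s : R) : of_real k (r + s) = of_real k r + of_real k s.
Proof. by case: k => //=; rewrite rmorphD. Qed.

Lemma of_realM (r s : R) : of_real k (r * s) = of_real k r * of_real k s.
Proof. by case: k => //=; rewrite rmorphM. Qed.

End scalar_theory.

Lemma complex_complete (R : realType) (F : set_system R[i]^o) :
  ProperFilter F -> cauchy F -> cvg F.
Proof.
move=> FF /cauchy_ballP Fc.
have proj (p : R[i] -> R) : (forall x y, p (x - y) = p x - p y) ->
    (forall x, (`|p x|)%:C%C <= `|x|) -> cvg (p x @[x --> F]).
  move=> pB ple; apply: R_complete; apply/cauchy_ballP => e e0.
  have eC0 : 0 < e%:C%C :> R[i] by rewrite ltcR.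
  have [[A B] [FA FB] AB] := Fc _ eC0.
  exists (p @` A, p @` B).
    by split; [apply: filterS FA|apply: filterS FB] => x ?; exists x.
  move=> [_ _] [] /= [x Ax <-] [y By <-].
  have := AB (x, y) (conj Ax By); rewrite /ball /= /ball_ /= => xye.
  by rewrite -pB -ltcR; exact: le_lt_trans xye.
have reB (x y : R[i]) : complex.Re (x - y) = complex.Re x - complex.Re y.
  by case: x y => ? ? [].
have imB (x y : R[i]) : complex.Im (x - y) = complex.Im x - complex.Im y.
  by case: x y => ? ? [].
have imle (x : R[i]) : (`|complex.Im x|)%:C%C <= `|x|.
  case: x => a b; rewrite normc_def /= lecR -sqrtr_sqr ler_sqrt ?lerDr ?sqr_ge0//.
  by rewrite addr_ge0 ?sqr_ge0.
have /cvg_ex[a ca] := proj _ reB (@normc_ge_Re R).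
have /cvg_ex[b cb] := proj _ imB imle.
apply/cvg_ex; exists (Complex a b : R[i]^o).
apply/cvgrPdist_lt => /= e.
rewrite ltcE /= => /andP[/eqP ei e0].
have e20 : 0 < complex.Re e / 2 by rewrite divr_gt0.
move/cvgrPdist_lt : ca => /(_ _ e20) ca.
move/cvgrPdist_lt : cb => /(_ _ e20) cb.
near=> x.
have -> : e = (complex.Re e)%:C%C by case: (e) ei => ? ? /= ->.
have dec (z : R[i]) : Complex a b - z =
    (a - complex.Re z)%:C%C + 'i%C * (b - complex.Im z)%:C%C.
  by case: z => z1 z2; simpc.
rewrite {}dec; apply: (le_lt_trans (ler_normD _ _)).
rewrite normrM !normc_def /= !(expr0n, addr0, add0r, expr1n, sqrtr_sqr, sqrtr1, normr0, normr1).
rewrite mul1r -rmorphD ltcR [ltRHS]splitr ltrD //.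
  by near: x.
by near: x.
Unshelve. all: by end_near. Qed.

Lemma scalar_complete (R : realType) (k : scalar_kind)
    (F : set_system (scalars R k)^o) : ProperFilter F -> cauchy F -> cvg F.
Proof. by case: k F => F; [exact: R_complete|exact: complex_complete]. Qed.

(* A norm over K = scalars R k takes its values in K; rnorm is the same norm
   read as an element of R (rnormE). *)
Definition rnorm (R : realType) (k : scalar_kind)
  (V : normedZmodType (scalars R k)) (x : V) : R := scalar_re `|x|.

Section rnorm_theory.
Variables (R : realType) (k : scalar_kind).
Local Notation K := (scalars R k).

Lemma rnormE (V : normedZmodType K) (x : V) : of_real k (rnorm x) = `|x|.
Proof. exact: scalar_reK. Qed.

Lemma rnorm_ge0 (V : normedZmodType K) (x : V) : 0 <= rnorm x.
Proof. by rewrite -(ler_of_real k) rnormE of_real0. Qed.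

Lemma rnorm_le (V : normedZmodType K) (x : V) (r : R) :
  (rnorm x <= r) = (`|x| <= of_real k r).
Proof. by rewrite -(ler_of_real k) rnormE. Qed.

Lemma rnorm_lt (V : normedZmodType K) (x : V) (r : R) :
  (rnorm x < r) = (`|x| < of_real k r).
Proof. by rewrite -(ltr_of_real k) rnormE. Qed.

Lemma ler_rnormD (V : normedZmodType K) (x y : V) :
  rnorm (x + y) <= rnorm x + rnorm y.
Proof. by rewrite rnorm_le of_realD !rnormE ler_normD. Qed.

Lemma rnormM (x y : K) : rnorm (x * y) = rnorm x * rnorm y.
Proof. by rewrite /rnorm normrM -!rnormE -of_realM of_realK !of_realK. Qed.

Lemma rnorm0 (V : normedZmodType K) : rnorm (0 : V) = 0.
Proof. by rewrite /rnorm normr0 -(of_real0 R k) of_realK. Qed.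

Lemma rnorm0_eq0 (V : normedZmodType K) (x : V) : rnorm x = 0 -> x = 0.
Proof. by move=> x0; apply/normr0_eq0; rewrite -rnormE x0 of_real0. Qed.

End rnorm_theory.

Section linf.
Variables (R : realType) (k : scalar_kind).
Local Notation K := (scalars R k).

Definition linf_pred : {pred nat -> K} :=
  [pred u : nat -> K | `[< bounded_fun (u : nat -> K^o) >]].

Lemma linf_predP (u : nat -> K) :
  reflect (exists M : R, forall n, rnorm (u n) <= M) (u \in linf_pred).
Proof.
rewrite inE; apply: (iffP (asboolP _)).
  move=> /(@ex_bound _ _ _ _ _ (@globally_properfilter _ setT 0%N I))[M uM]; exists (scalar_re M) => n.
  rewrite rnorm_le scalar_reK ?uM //.
  by apply: le_trans (uM 0 I).
move=> [M uM]; apply/(@ex_bound _ _ _ _ _ (@globally_properfilter _ setT 0%N I)); exists (of_real k M) => n _ /=.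
by rewrite -rnorm_le.
Qed.

Lemma linf_submod_closed : submod_closed linf_pred.
Proof.
split.
  by apply/linf_predP; exists 0 => n; rewrite rnorm0.
move=> a u v /linf_predP[M uM] /linf_predP[N vN].
apply/linf_predP; exists (rnorm a * M + N) => n.
rewrite (le_trans (ler_rnormD _ _)) ?lerD //.
by rewrite rnormM ler_wpM2l ?rnorm_ge0.
Qed.

HB.instance Definition _ :=
  GRing.isSubmodClosed.Build _ _ linf_pred linf_submod_closed.

Record linf := Linf { linf_seq :> nat -> K ; linf_seqP : linf_seq \in linf_pred }.

HB.instance Definition _ := [isSub for linf_seq].
HB.instance Definition _ := [Choice of linf by <:].
HB.instance Definition _ := [SubChoice_isSubLmodule of linf by <:].

Definition linf_rnorm (u : linf) : R := sup (range (fun n => rnorm (u n))).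

Lemma linf_rnorm_ge (u : linf) n : rnorm (u n) <= linf_rnorm u.
Proof.
have /linf_predP[M uM] := linf_seqP u.
apply: ub_le_sup; last by exists n.
by exists M => _ [m _ <-].
Qed.

Lemma linf_rnorm_le (u : linf) M :
  (forall n, rnorm (u n) <= M) -> linf_rnorm u <= M.
Proof.
move=> uM; apply: ge_sup => [|_ [m _ <-]//].
by exists (rnorm (u 0)); exists 0.
Qed.

Definition linf_norm (u : linf) : K := of_real k (linf_rnorm u).

Lemma ler_linf_normD u v : linf_norm (u + v) <= linf_norm u + linf_norm v.
Proof.
rewrite -of_realD ler_of_real; apply: linf_rnorm_le => n.
by rewrite (le_trans (ler_rnormD _ _)) // lerD ?linf_rnorm_ge.
Qed.

Lemma linf_normZ (a : K) u : linf_norm (a *: u) = `|a| * linf_norm u.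
Proof.
rewrite -rnormE -of_realM; congr of_real; apply/eqP.
have H b v : linf_rnorm (b *: v) <= rnorm b * linf_rnorm v.
  apply: linf_rnorm_le => n /=.
  by rewrite rnormM ler_wpM2l ?rnorm_ge0 ?linf_rnorm_ge.
rewrite eq_le H /=.
have [->|a0] := eqVneq a 0.
  by rewrite rnorm0 mul0r (le_trans (rnorm_ge0 _) (linf_rnorm_ge _ 0)).
have := H a^-1 (a *: u); rewrite scalerA mulVf // scale1r => /(ler_wpM2l (rnorm_ge0 a)).
rewrite mulrA -rnormM mulfV //.
suff -> : rnorm (1 : K) = 1 by rewrite mul1r.
by rewrite /rnorm normr1 -(of_real1 R k) of_realK.
Qed.

Lemma linf_norm0_eq0 u : linf_norm u = 0 -> u = 0.
Proof.
move=> /(congr1 (@scalar_re R k)); rewrite of_realK -(of_real0 R k) of_realK => u0.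
apply: val_inj; apply/funext => n /=; apply: rnorm0_eq0.
by apply/eqP; rewrite eq_le rnorm_ge0 -u0 linf_rnorm_ge.
Qed.

HB.instance Definition _ :=
  Lmodule_isNormed.Build K linf ler_linf_normD linf_normZ linf_norm0_eq0.

Lemma linf_normE (u : linf) : rnorm u = sup (range (fun n => rnorm (u n))).
Proof. by rewrite /rnorm [`|u|]/(linf_norm u) of_realK. Qed.

Lemma linf_complete (F : set_system linf) : ProperFilter F -> cauchy F -> cvg F.
Proof.
move=> FF /cauchy_ballP Fc.
have Fb (e : R) : 0 < e ->
    exists2 A, F A & forall u v, A u -> A v -> forall n, rnorm (u n - v n) < e.
  move=> e0; have eK : 0 < of_real k e by rewrite -(of_real0 R k) ltr_of_real.
  have [[A B] [FA FB] AB] := Fc _ eK.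
  exists (A `&` B) => [|u v [Au _] [_ Bv] n]; first exact: filterI.
  have := AB (u, v) (conj Au Bv); rewrite -ball_normE /= -rnorm_lt linf_normE.
  exact/le_lt_trans/(linf_rnorm_ge (u - v)).
have cn n : cvg ((fun u : linf => u n : K^o) @ F).
  apply: scalar_complete; apply/cauchy_ballP => e e0.
  have [|A FA AF] := Fb (scalar_re e).
    by rewrite -(ltr_of_real k) scalar_reK ?ltW// of_real0.
  exists ((fun u : linf => u n) @` A, (fun u : linf => u n) @` A).
    by split; rewrite /= /nbhs /=; apply: filterS FA => u ?; exists u.
  move=> [_ _] [] /= [u Au <-] [v Av <-].
  rewrite -ball_normE /= -[e]scalar_reK ?ltW// -rnorm_lt; exact: AF.
pose l n : K := lim ((fun u : linf => u n : K^o) @ F).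
have Fl (e : R) : 0 < e ->
    exists2 A, F A & forall u, A u -> forall n, rnorm (l n - u n) <= e.
  move=> e0; have [|A FA AF] := Fb (e / 2); first by rewrite divr_gt0.
  exists A => // u Au n.
  have eK : 0 < of_real k (e / 2) by rewrite -(of_real0 R k) ltr_of_real divr_gt0.
  have /cvgrPdist_lt /(_ _ eK) H := cn n.
  have [v [Av lv]] := filter_ex (filterI FA H).
  rewrite (_ : l n - u n = (l n - v n) + (v n - u n)); last by rewrite addrA subrK.
  apply: (le_trans (ler_rnormD _ _)); rewrite [leRHS]splitr lerD //.
    by rewrite ltW // rnorm_lt.
  by rewrite ltW // AF.
have lP : l \in linf_pred.
  have [A FA AF] := Fl 1 ltr01.
  have [u Au] := filter_ex FA.
  apply/linf_predP; exists (1 + rnorm u) => n.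
  rewrite -[l n](subrK (u n)) (le_trans (ler_rnormD _ _)) // lerD ?AF //.
  by rewrite linf_normE linf_rnorm_ge.
apply/cvg_ex; exists (Linf lP); apply/cvgrPdist_le => e e0.
have [|A FA AF] := Fl (scalar_re e).
  by rewrite -(ltr_of_real k) scalar_reK ?ltW// of_real0.
apply: filterS FA => u Au.
rewrite /= -(scalar_reK (ltW e0)) -rnorm_le linf_normE.
by apply: linf_rnorm_le => n; exact: AF.
Qed.

HB.instance Definition _ := Uniform_isComplete.Build linf linf_complete.

End linf.

Section c0.
Variables (R : realType) (k : scalar_kind).
Local Notation K := (scalars R k).
Local Notation linf := (linf R k).

Definition c0_pred : {pred linf} :=
  [pred u : linf | `[< u n @[n --> \oo] --> (0 : K^o) >]].

Lemma c0_predP (u : linf) :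
  reflect (u n @[n --> \oo] --> (0 : K^o)) (u \in c0_pred).
Proof. by rewrite inE; exact: asboolP. Qed.

Lemma c0_submod_closed : submod_closed c0_pred.
Proof.
split; first by apply/c0_predP; exact: (@cvg_cst K^o).
move=> a u v /c0_predP u0 /c0_predP v0; apply/c0_predP.
have := cvgD (@cvgZl_tmp _ K^o _ _ _ a _ _ u0) v0; rewrite scaler0 addr0; exact.
Qed.

HB.instance Definition _ :=
  GRing.isSubmodClosed.Build _ _ c0_pred c0_submod_closed.

Record c0 := C0 { c0_linf :> linf ; c0_linfP : c0_linf \in c0_pred }.

HB.instance Definition _ := [isSub for c0_linf].
HB.instance Definition _ := [Choice of c0 by <:].
HB.instance Definition _ := [SubChoice_isSubLmodule of c0 by <:].

Definition c0_norm (u : c0) : K := `|c0_linf u|.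

Lemma ler_c0_normD u v : c0_norm (u + v) <= c0_norm u + c0_norm v.
Proof. exact: ler_normD. Qed.

Lemma c0_normZ (a : K) u : c0_norm (a *: u) = `|a| * c0_norm u.
Proof. exact: normrZ. Qed.

Lemma c0_norm0_eq0 u : c0_norm u = 0 -> u = 0.
Proof. by move=> /normr0_eq0 u0; exact: val_inj. Qed.

HB.instance Definition _ :=
  Lmodule_isNormed.Build K c0 ler_c0_normD c0_normZ c0_norm0_eq0.

Lemma c0_complete (F : set_system c0) : ProperFilter F -> cauchy F -> cvg F.
Proof.
move=> FF /cauchy_ballP Fc.
have /cvg_ex[l Fl] : cvg (c0_linf u @[u --> F]).
  apply: cauchy_cvg; apply/cauchy_ballP => e /Fc [[A B] [FA FB] AB].
  exists (c0_linf @` A, c0_linf @` B).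
    by split; rewrite /= /nbhs /=; [apply: filterS FA|apply: filterS FB] => u ?; exists u.
  move=> [_ _] [] /= [u Au <-] [v Bv <-].
  by have := AB (u, v) (conj Au Bv); rewrite -!ball_normE.
have lP : l \in c0_pred.
  apply/c0_predP/cvgrPdist_lt => /= e e0.
  have e20 : 0 < e / 2 by rewrite divr_gt0.
  move/cvgrPdist_lt : Fl => /(_ _ e20) /filter_ex[u lu].
  have /c0_predP/cvgrPdist_lt := c0_linfP u; move=> /(_ _ e20).
  apply: filterS => n; rewrite !sub0r !normrN => un.
  rewrite -[l n](subrK (u n)) (le_lt_trans (ler_normD _ _)) // [ltRHS]splitr ltrD //.
  apply: le_lt_trans lu.
  by rewrite -!rnormE ler_of_real linf_normE; exact: (linf_rnorm_ge (l - u)).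
by apply/cvg_ex; exists (C0 lP); apply/cvgrPdist_lt => e e0; move/cvgrPdist_lt : Fl => /(_ _ e0).
Qed.

HB.instance Definition _ := Uniform_isComplete.Build c0 c0_complete.

End c0.

Section BPBZp.
Variables (R : realType) (k : scalar_kind).
Local Notation K := (scalars R k).

(* Meaningful for bounded linear T only: sup of an unbounded set is 0. *)
Definition opnorm (V W : normedModType K) (T : V -> W) : R :=
  sup [set rnorm (T x) | x in [set x : V | rnorm x <= 1]].

(* D is the domain of eta. A linear map is bounded near 0 if and only if it is
   a bounded operator, if and only if it is continuous: see linear_boundedP and
   linear_bounded_continuous. *)
Definition BPBZp_with (X Y : completeNormedModType K)
    (D : set R) (eta : R -> R) : Prop :=
  forall eps, D eps ->
    0 < eta eps /\
    forall (T : {linear X -> Y}) (y0 : {linear Y -> K^o}) (x0 : X),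
      bounded_near T (nbhs (0 : X)) -> opnorm T = 1 ->
      continuous y0 -> opnorm y0 = 1 ->
      rnorm x0 = 1 ->
      1 - eta eps < rnorm (y0 (T x0)) ->
    exists (y1 : {linear Y -> K^o}) (x1 : X) (S : {linear X -> Y}),
      [/\ continuous y1 /\ opnorm y1 = 1,
          rnorm x1 = 1,
          bounded_near S (nbhs (0 : X)) /\ opnorm S = 1,
          rnorm (y1 (S x1)) = 1 &
          [/\ rnorm (x1 - x0) < eps,
              opnorm (y1 \- y0) < eps &
              opnorm (S \- T) < eps]].

End BPBZp.

(* Main.v *)
(* Write P_N for the truncation of a sequence to its first N terms. If the unit
   functional f almost attains its norm at P_N u, then f is small on the unit
   sequences supported outside [0, N), since such a sequence w can be added to
   P_N u, with any phase, without leaving the unit ball. Hence a unit functional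
   y0 on c0 is close to y0 \o P_N for N large, which after normalization extends
   y0 to l_infty up to an arbitrarily small error.
   The hypothesis then gives z1, x1 and S with |z1 (S x1)| = 1. As S is within
   eps / 2 < 1 / 2 of T, whose values are in c0, |(S x1) n| is bounded away from 1
   for n >= M. The same argument, now with norm attainment, shows that
   z1 = z1 \o P_M. So S may be replaced, outside the first M coordinates, by T,
   which makes it c0-valued without changing z1 (S x1). *)
From HB Require Import structures.
Require Import Defs.
From mathcomp Require Import all_boot all_order all_algebra.
From mathcomp Require Import all_classical all_reals all_analysis.
From mathcomp Require Import lra.
Import Order.TTheory GRing.Theory Num.Theory.
Import numFieldNormedType.Exports.
Local Open Scope classical_set_scope.
Local Open Scope ring_scope.

(** * Real-valued norms and phases of scalars *)

Section rnorm.
Context {R : realType} {k : scalar_kind}.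
Local Notation K := (scalars R k).

Lemma rnorm_of_real (r : R) : 0 <= r -> rnorm (of_real k r : K) = r.
Proof.
move=> r0; rewrite /rnorm ger0_norm ?of_realK//.
by rewrite -(of_real0 R k) ler_of_real.
Qed.

Lemma rnorm1 : rnorm (1 : K) = 1.
Proof. by rewrite -(of_real1 R k) rnorm_of_real. Qed.

Lemma rnormZ {V : normedModType K} (a : K) (x : V) :
  rnorm (a *: x) = rnorm a * rnorm x.
Proof. by rewrite /rnorm normrZ -!rnormE -of_realM of_realK !of_realK. Qed.

Lemma rnormN {V : normedZmodType K} (x : V) : rnorm (- x) = rnorm x.
Proof. by rewrite /rnorm normrN. Qed.

Lemma ler_rnormB {V : normedZmodType K} (x y : V) :
  rnorm x <= rnorm y + rnorm (x - y).
Proof. by have := ler_rnormD y (x - y); rewrite subrKC. Qed.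

(** For nonzero [a] and [b], [c] is chosen so that [c * b] is [a] scaled by the positive real
    [rnorm b / rnorm a]. *)
Lemma rnorm_phase (a b : K) :
  exists2 c : K, rnorm c = 1 & rnorm (a + c * b) = rnorm a + rnorm b.
Proof.
have [->|b0] := eqVneq b 0.
  by exists 1; rewrite ?rnorm1// mulr0 rnorm0 !addr0.
have [->|a0] := eqVneq a 0.
  by exists 1; rewrite ?rnorm1// mul1r rnorm0 !add0r.
have na : rnorm a != 0 by apply: contra_neq a0; exact: rnorm0_eq0.
have nb : rnorm b != 0 by apply: contra_neq b0; exact: rnorm0_eq0.
pose t : K := of_real k (rnorm b / rnorm a).
have t0 : 0 <= rnorm b / rnorm a by rewrite divr_ge0 ?rnorm_ge0.
exists (a * t / b).
  apply: (mulIf nb); rewrite -rnormM divfK// rnormM /t rnorm_of_real//.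
  by rewrite mulrC divfK// mul1r.
rewrite divfK// -[X in X + _]mulr1 -mulrDr rnormM -(of_real1 R k) -of_realD.
by rewrite rnorm_of_real ?addr_ge0// mulrDr mulr1 (mulrC _ (_ / _)) divfK.
Qed.

End rnorm.

(** * Operator norms as suprema over the unit ball *)

Section opnorm.
Context {R : realType} {k : scalar_kind} {V W : normedModType (scalars R k)}.
Local Notation K := (scalars R k).

Lemma opnorm_le (f : V -> W) (M : R) :
  (forall x, rnorm x <= 1 -> rnorm (f x) <= M) -> opnorm f <= M.
Proof.
move=> fM; apply: ge_sup => [|_ [x x1 <-]]; last exact: fM.
by exists (rnorm (f 0)); exists 0; rewrite //= rnorm0.
Qed.

Lemma opnorm_ub (f : V -> W) (M : R) :
  (forall x, rnorm x <= 1 -> rnorm (f x) <= M) ->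
  forall x, rnorm x <= 1 -> rnorm (f x) <= opnorm f.
Proof.
move=> fM x x1; apply: ub_le_sup; last by exists x.
by exists M => _ [y y1 <-]; exact: fM.
Qed.

Lemma opnorm_adherent (f : V -> W) (d : R) : 0 < opnorm f -> 0 < d ->
  exists2 x, rnorm x <= 1 & opnorm f - d < rnorm (f x).
Proof.
move=> f0 d0.
(* [sup] is 0 on a set without a supremum, so a positive [opnorm] is a genuine supremum. *)
have fS : has_sup [set rnorm (f x) | x in [set x : V | rnorm x <= 1]].
  by apply: contrapT => nf; move: f0; rewrite /opnorm sup_out ?ltxx.
by have [_ [x x1 <-] fx] := sup_adherent d0 fS; exists x.
Qed.

Lemma linear_rnorm_le (f : {linear V -> W}) (M : R) :
  (forall x, rnorm x <= 1 -> rnorm (f x) <= M) ->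
  forall x, rnorm (f x) <= M * rnorm x.
Proof.
move=> fM x; have [->|x0] := eqVneq x 0.
  by rewrite linear0 !rnorm0 mulr0.
have nx : 0 < rnorm x.
  by rewrite lt_neqAle rnorm_ge0 andbT eq_sym; apply: contra_neq x0; exact: rnorm0_eq0.
have nK : rnorm (of_real k (rnorm x)^-1 : K) = (rnorm x)^-1.
  by rewrite rnorm_of_real ?invr_ge0 ?rnorm_ge0.
have := fM (of_real k (rnorm x)^-1 *: x).
rewrite linearZ !rnormZ nK mulVf ?gt_eqF// => /(_ (lexx _)).
by rewrite mulrC ler_pdivrMr.
Qed.

Lemma linear_bounded_nearP (f : {linear V -> W}) :
  bounded_near f (nbhs (0 : V)) <->
  exists M : R, forall x, rnorm x <= 1 -> rnorm (f x) <= M.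
Proof.
rewrite linear_boundedP; split.
  move=> /pinfty_ex_gt0[r r0 fr]; exists (scalar_re r) => x.
  rewrite !rnorm_le of_real1 (scalar_reK (ltW r0)) => x1.
  by rewrite (le_trans (fr x))// ler_piMr// ltW.
(* The absolute value makes every [r] above the bound nonnegative, hence real, so the inequality can
   be read in [R]. *)
move=> [M /linear_rnorm_le fM]; exists (of_real k `|M|); split.
  by rewrite realE -(of_real0 R k) ler_of_real normr_ge0.
move=> r Mr x; have r0 : 0 <= r.
  by rewrite (le_trans _ (ltW Mr))// -(of_real0 R k) ler_of_real.
rewrite -(rnormE (f x)) -(rnormE x) -(scalar_reK r0) -of_realM ler_of_real.
rewrite (le_trans (fM x))// ler_wpM2r ?rnorm_ge0// (le_trans (ler_norm M))//.
by rewrite -(ler_of_real k) scalar_reK// ltW.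
Qed.

Lemma bounded_opnorm (f : {linear V -> W}) : bounded_near f (nbhs (0 : V)) ->
  forall x, rnorm x <= 1 -> rnorm (f x) <= opnorm f.
Proof. by move=> /linear_bounded_nearP[M]; exact: opnorm_ub. Qed.

Lemma continuous_opnorm (f : {linear V -> W}) : continuous f ->
  forall x, rnorm x <= 1 -> rnorm (f x) <= opnorm f.
Proof. by move=> /linear_bounded_continuous; exact: bounded_opnorm. Qed.

Lemma rnorm_le_continuous (f : {linear V -> W}) (M : R) :
  (forall x, rnorm x <= 1 -> rnorm (f x) <= M) -> continuous f.
Proof.
by move=> fM; apply/linear_bounded_continuous/linear_bounded_nearP; exists M.
Qed.

Lemma opnorm_eq (f : V -> W) (M : R) (x : V) :
  (forall x, rnorm x <= 1 -> rnorm (f x) <= M) ->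
  rnorm x <= 1 -> M <= rnorm (f x) -> opnorm f = M.
Proof.
move=> fM x1 Mx; apply/eqP; rewrite eq_le opnorm_le//=.
exact: le_trans Mx (opnorm_ub _ _ fM _ x1).
Qed.

(* Rotating w so that f u and f w have the same argument, |f u| + |f w| is the
   value of |f| at a point of the unit ball. *)
Lemma rnorm_disjointD (f : {linear V -> K^o}) (M : R) (u w : V) :
  (forall x, rnorm x <= 1 -> rnorm (f x) <= M) ->
  (forall c : K, rnorm c = 1 -> rnorm (u + c *: w) <= 1) ->
  rnorm (f u) + rnorm (f w) <= M.
Proof.
move=> fM uw; have [c c1 fuw] := rnorm_phase (f u) (f w).
by have := fM _ (uw _ c1); rewrite linearD linearZ/= fuw.
Qed.

End opnorm.

(** * Truncation and splicing of sequences *)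

Section sequence_spaces.
Context {R : realType} {k : scalar_kind}.
Local Notation K := (scalars R k).
Local Notation linf := (linf R k).
Local Notation c0 := (c0 R k).

Lemma c0_linf_is_linear : linear (@c0_linf R k).
Proof. by []. Qed.

HB.instance Definition _ :=
  GRing.isLinear.Build K c0 linf _ (@c0_linf R k) c0_linf_is_linear.

Lemma rnorm_linfP (u : linf) (M : R) :
  rnorm u <= M <-> forall n, rnorm (u n) <= M.
Proof.
rewrite linf_normE; split=> [uM n|]; last exact: linf_rnorm_le.
exact: le_trans (linf_rnorm_ge u n) uM.
Qed.

Lemma rnorm_c0P (u : c0) (M : R) :
  rnorm u <= M <-> forall n, rnorm (u n) <= M.
Proof. exact: rnorm_linfP. Qed.

Lemma c0_tail (u : c0) (d : R) : 0 < d ->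
  \forall n \near \oo, rnorm (u n) <= d.
Proof.
move=> d0; have /c0_predP/cvgrPdist_le /(_ (of_real k d)) := c0_linfP u.
rewrite -{1}(of_real0 R k) ltr_of_real => /(_ d0).
by apply: filterS => n; rewrite sub0r normrN -rnorm_le.
Qed.

Definition trunc_seq (N : nat) (u : nat -> K) (n : nat) : K :=
  if (n < N)%N then u n else 0.

Lemma trunc_linfP N (u : linf) : trunc_seq N u \in linf_pred (R := R) (k := k).
Proof.
apply/linf_predP; exists (rnorm u) => n; rewrite /trunc_seq.
by case: ifP => _; [exact: (rnorm_linfP u _).1|rewrite rnorm0 rnorm_ge0].
Qed.

Lemma trunc_c0P N (u : linf) : Linf (trunc_linfP N u) \in c0_pred (R := R) (k := k).
Proof.
apply/c0_predP; apply: (@cvg_near_cst _ K^o); exists N => // n /= Nn.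
by rewrite /trunc_seq ltnNge Nn.
Qed.

Definition trunc N (u : linf) : c0 := C0 (trunc_c0P N u).

Lemma truncE N u n : trunc N u n = if (n < N)%N then u n else 0.
Proof. by []. Qed.

Lemma trunc_is_linear N : linear (trunc N).
Proof.
move=> a u v; apply/val_inj/val_inj/funext => n.
change (trunc_seq N (a *: u + v) n = a * trunc_seq N u n + trunc_seq N v n).
by rewrite /trunc_seq; case: ifP => // _; rewrite mulr0 addr0.
Qed.

HB.instance Definition _ N :=
  GRing.isLinear.Build K linf c0 _ (trunc N) (trunc_is_linear N).

(** A bounded head is glued to a null tail, which stays in [c0] even if [u] does not. With [S x] and
    [T x] for [u] and [v], this is the corrected operator of the theorem. *)
Lemma splice_truncE N (u : linf) (v : c0) n :
  (trunc N u + (v - trunc N v)) n = if (n < N)%N then u n else v n.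
Proof.
change (trunc N u n + (v n - trunc N v n) = if (n < N)%N then u n else v n).
by rewrite !truncE; case: ifP; rewrite ?subrr ?addr0// subr0 add0r.
Qed.

Lemma rnorm_splice_le N (u : linf) (v : c0) (M : R) :
  rnorm u <= M -> rnorm v <= M -> rnorm (trunc N u + (v - trunc N v)) <= M.
Proof.
move=> uM vM; apply/rnorm_c0P => n.
rewrite splice_truncE; case: ifP => _; first exact: (rnorm_linfP u M).1.
exact: (rnorm_c0P v M).1.
Qed.

Lemma rnorm_spliceB_le N (u : linf) (v : c0) (M : R) :
  rnorm (u - v : linf) <= M ->
  rnorm (trunc N u + (v - trunc N v) - v) <= M.
Proof.
move=> uvM; have uvMn := (rnorm_linfP (u - v : linf) M).1 uvM.
apply/rnorm_c0P => n.
change (rnorm ((trunc N u + (v - trunc N v)) n - v n) <= M).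
rewrite splice_truncE; case: ifP => _; first exact: uvMn.
by rewrite subrr rnorm0 (le_trans (rnorm_ge0 _) uvM).
Qed.

Lemma trunc_splice N (u : linf) (v : c0) :
  trunc N (trunc N u + (v - trunc N v)) = trunc N u.
Proof.
apply/val_inj/val_inj/funext => n.
change (trunc N (trunc N u + (v - trunc N v)) n = trunc N u n).
by rewrite !truncE; case: ifP => // nN; rewrite splice_truncE nN.
Qed.

Lemma rnorm_trunc_le N (u : linf) (M : R) : rnorm u <= M ->
  rnorm (trunc N u) <= M.
Proof.
move=> uM; apply/rnorm_c0P => n; rewrite truncE.
case: ifP => _; first exact: (rnorm_linfP u M).1.
by rewrite rnorm0 (le_trans (rnorm_ge0 u)).
Qed.

Lemma rnorm_trunc_tail (u : c0) (d : R) : 0 < d ->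
  \forall N \near \oo, rnorm (u - trunc N u) <= d.
Proof.
move=> d0; have [N _ uN] := c0_tail u d d0; exists N => // m Nm.
apply/rnorm_c0P => n.
change (rnorm (u n - trunc m u n) <= d); rewrite truncE; case: ltnP => mn.
  by rewrite subrr rnorm0 ltW.
by rewrite subr0; apply: uN => /=; exact: leq_trans Nm mn.
Qed.

(** The summands have disjoint supports, so the sup norm of the sum is the larger of their norms. *)
Lemma rnorm_trunc_disjoint N (u w : c0) (c : K) :
  rnorm u <= 1 -> rnorm w <= 1 -> rnorm c = 1 ->
  rnorm (trunc N u + c *: (w - trunc N w)) <= 1.
Proof.
move=> u1 w1 c1; apply/rnorm_c0P => n.
change (rnorm (trunc N u n + c * (w n - trunc N w n)) <= 1); rewrite !truncE.
case: ltnP => _; first by rewrite subrr mulr0 addr0; exact: (rnorm_c0P u 1).1.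
by rewrite subr0 add0r rnormM c1 mul1r; exact: (rnorm_c0P w 1).1.
Qed.

(** * Functionals on [c0] and [linf] *)

Lemma c0_functional_tail (f : {linear c0 -> K^o}) (d : R) :
  continuous f -> opnorm f = 1 -> 0 < d ->
  \forall N \near \oo, forall w : c0, rnorm w <= 1 ->
    rnorm (f (w - trunc N w)) <= d.
Proof.
move=> fc f1 d0; have d20 : 0 < d / 2 by rewrite divr_gt0.
have fle := continuous_opnorm _ fc; rewrite f1 in fle.
(* Half of [d] pays for [u] not attaining the norm, half for truncating it: [rnorm (f (trunc N u))]
   exceeds [1 - d]. *)
have [|u u1 fu] := opnorm_adherent f (d / 2) _ d20; first by rewrite f1.
apply: filterS (rnorm_trunc_tail u _ d20) => N uN w w1.
have fuN : rnorm (f (u - trunc N u)) <= d / 2.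
  have := linear_rnorm_le _ _ fle (u - trunc N u); rewrite mul1r => fuN.
  exact: le_trans fuN uN.
have := ler_rnormB (f u) (f (trunc N u)); rewrite -linearB => fuD.
have := rnorm_disjointD f 1 (trunc N u) (w - trunc N w) fle
  (fun c => rnorm_trunc_disjoint N u w c u1 w1).
rewrite f1 in fu; lra.
Qed.

Lemma c0_functional_extension (y : {linear c0 -> K^o}) (d : R) :
  continuous y -> opnorm y = 1 -> 0 < d ->
  exists h : {linear linf -> K^o}, [/\ continuous h, opnorm h = 1 &
    forall w : c0, rnorm w <= 1 -> rnorm (h w - y w) <= d].
Proof.
move=> yc y1 d0; have yle := continuous_opnorm _ yc; rewrite y1 in yle.
(* Truncation and normalization each cost at most [t <= d / 2]; [t <= 1 / 2] keeps [c >= 1 - t] away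
   from 0. *)
pose t := Num.min (d / 2) 2^-1.
have t0 : 0 < t by rewrite lt_min divr_gt0 /= ?invr_gt0 ?ltr0n.
have td : t <= d / 2 by rewrite ge_min lexx.
have t1 : t <= 2^-1 by rewrite ge_min lexx orbT.
have [N _ /(_ N (leqnn N)) yN] := c0_functional_tail _ _ yc y1 t0.
pose g : {linear linf -> K^o} := y \o trunc N.
have {}yN (w : c0) : rnorm w <= 1 -> rnorm (y w - g w) <= t.
  by move=> /yN; rewrite linearB.
have g1 u : rnorm u <= 1 -> rnorm (g u) <= 1.
  by move=> /(rnorm_trunc_le N)/yle.
pose c := opnorm g.
have gle : forall u, rnorm u <= 1 -> rnorm (g u) <= c := opnorm_ub _ _ g1.
have c1 : c <= 1 by exact: opnorm_le.
have ct : 1 <= c + t.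
  rewrite -y1; apply: opnorm_le => w w1.
  rewrite (le_trans (ler_rnormB _ (g w)))// lerD ?yN//; exact: gle.
have c0 : 0 < c by clear -ct t1; lra.
have ci : 0 <= c^-1 - 1 by rewrite subr_ge0 invf_ge1.
pose h : {linear linf -> K^o} := of_real k c^-1 \*: g.
have hE u : rnorm (h u) = c^-1 * rnorm (g u).
  by rewrite rnormZ rnorm_of_real// invr_ge0 ltW.
have h1 u : rnorm u <= 1 -> rnorm (h u) <= 1.
  by move=> u1; rewrite hE ler_pdivrMl// mulr1 gle.
(* Normalizing moves [g] by at most [(c^-1 - 1) * c = 1 - c <= t]. *)
have hg u : rnorm u <= 1 -> rnorm (h u - g u) <= t.
  move=> u1; have -> : h u - g u = of_real k (c^-1 - 1) *: g u.
    apply/eqP; rewrite subr_eq -[X in _ + X]scale1r -scalerDl.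
    by rewrite -(of_real1 R k) -of_realD subrK.
  rewrite rnormZ rnorm_of_real// (le_trans (ler_wpM2l ci (gle _ u1)))//.
  by rewrite mulrBl mul1r mulVf ?gt_eqF// lerBlDl.
exists h; split => [||w w1]; first exact: rnorm_le_continuous h1.
  apply/eqP; rewrite eq_le opnorm_le//= -(ler_pM2l c0) mulr1.
  apply: opnorm_le => u u1.
  by rewrite -ler_pdivrMl// -hE; exact: opnorm_ub h1 _ u1.
have -> : h w - y w = (h w - g w) - (y w - g w) by rewrite opprB addrA subrK.
rewrite (le_trans (ler_rnormD _ _))// rnormN.
by rewrite [leRHS]splitr lerD ?(le_trans (hg _ w1))// (le_trans (yN _ w1)).
Qed.

(** From [N] on, [u] leaves room [1 - r] for the tail of [w] scaled by [1 - r], with any phase. As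
    [f] already attains 1 at [u], it must vanish on that tail, exactly and not up to an error. *)
Lemma linf_functional_attaining_trunc (f : {linear linf -> K^o}) (u w : linf)
    (r : R) (N : nat) :
  (forall x, rnorm x <= 1 -> rnorm (f x) <= 1) ->
  rnorm u <= 1 -> rnorm (f u) = 1 ->
  r < 1 -> (forall n, (N <= n)%N -> rnorm (u n) <= r) ->
  rnorm w <= 1 -> f w = f (trunc N w).
Proof.
move=> fle u1 fu r1 ur w1; apply/eqP; rewrite -subr_eq0 -linearB; apply/eqP.
apply: (@rnorm0_eq0 R k); have r0 : 0 < 1 - r by rewrite subr_gt0.
have rK : rnorm (of_real k (1 - r) : K) = 1 - r by rewrite rnorm_of_real// ltW.
have : rnorm (f u) + rnorm (f (of_real k (1 - r) *: (w - trunc N w))) <= 1.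
  apply: rnorm_disjointD fle _ => c c1; apply/rnorm_linfP => n.
  change (rnorm (u n + c * (of_real k (1 - r) * (w n - trunc N w n))) <= 1).
  rewrite truncE; case: ltnP => Nn.
    by rewrite subrr !mulr0 addr0; exact: (rnorm_linfP u 1).1.
  rewrite subr0 (le_trans (ler_rnormD _ _))// !rnormM c1 mul1r rK.
  rewrite -[leRHS](subrKC r) lerD ?ur// ler_piMr ?(ltW r0)//.
  exact: (rnorm_linfP w 1).1.
rewrite linearZ rnormZ rK fu gerDl pmulr_rle0// => fw.
by apply/eqP; rewrite eq_le fw rnorm_ge0.
Qed.

End sequence_spaces.

(** * Transfer of the property from [linf] to [c0] *)

Theorem theorem3p9 (R : realType) (k : scalar_kind)
    (X : completeNormedModType (scalars R k)) (eta : R -> R) :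
  BPBZp_with X (linf R k) [set eps | 0 < eps] eta ->
  BPBZp_with X (c0 R k) [set eps | 0 < eps < 1] (fun eps => eta (eps / 2)).
Proof.
move=> bpb eps /andP[eps0 eps1]; have e20 : 0 < eps / 2 by rewrite divr_gt0.
have [eta0 {}bpb] := bpb _ e20; split=> // T y0 x0 Tb T1 y0c y01 x01 y0T.
have Tle := bounded_opnorm _ Tb; rewrite T1 in Tle.
(* The first term keeps the final functional within [eps] of [y0]; the second keeps [h (T x0)] above
   the threshold [1 - eta (eps / 2)]. *)
pose d := Num.min (eps / 2) (rnorm (y0 (T x0)) - (1 - eta (eps / 2))) / 2.
have d0 : 0 < d by rewrite divr_gt0// lt_min e20 subr_gt0.
have [de dy] : d < eps / 2 /\ d < rnorm (y0 (T x0)) - (1 - eta (eps / 2)).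
  by apply/andP; rewrite -lt_min /d gtr_pMr ?lt_min ?e20 ?subr_gt0// invf_lt1// ltr1n.
have [h [hc hn hy0]] := c0_functional_extension y0 d y0c y01 d0.
have hle := continuous_opnorm _ hc; rewrite hn in hle.
pose JT : {linear X -> linf R k} := @c0_linf R k \o T.
have [||||||z1 [x1 [S]]] := bpb JT h x0.
- exact/linear_bounded_nearP/(ex_intro _ 1).
- exact: T1.
- exact: hc.
- exact: hn.
- exact: x01.
- apply: (@lt_le_trans _ _ (rnorm (y0 (T x0)) - d)).
    by rewrite ltrBrDr -ltrBrDl.
  rewrite lerBlDr (le_trans (ler_rnormB _ (h (T x0))))// lerD//.
  by rewrite -rnormN opprB hy0// Tle// x01.
move=> [[z1c z1n] x1n [Sb Sn] zS [x1e z1e Se]].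
have x1le : rnorm x1 <= 1 by rewrite x1n.
have Sle := bounded_opnorm _ Sb; rewrite Sn in Sle.
have z1le := continuous_opnorm _ z1c; rewrite z1n in z1le.
have STle : forall x, rnorm x <= 1 -> rnorm (S x - JT x) <= opnorm (S \- JT).
  (* The crude bound 2 ensures that the supremum is not the default value 0. *)
  apply: (opnorm_ub (S \- JT) (1 + 1)) => x xle.
  by rewrite (le_trans (ler_rnormD _ _))// rnormN lerD ?Sle//; exact: Tle.
have zhle : forall u, rnorm u <= 1 -> rnorm (z1 u - h u) <= opnorm (z1 \- h).
  apply: (opnorm_ub (z1 \- h) (1 + 1)) => u ule.
  by rewrite (le_trans (ler_rnormD _ _))// rnormN lerD ?z1le ?hle.
(* With [eps < 1], [S] is within 1/2 of [T], so a tail of [T x1] below 1/4 gives [r < 3 / 4]. *)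
have [M _ Tx1M] := c0_tail (T x1) 4^-1 ltac:(by rewrite invr_gt0).
pose r := 4^-1 + opnorm (S \- JT).
have r1 : r < 1 by move: Se; rewrite /r; move: (opnorm _) => o; clear -eps1; lra.
have Sx1M n : (M <= n)%N -> rnorm (S x1 n) <= r.
  move=> /Tx1M /= Tn; rewrite (le_trans (ler_rnormB _ (T x1 n)))// lerD//.
  exact: (rnorm_linfP (S x1 - JT x1) _).1 (STle _ x1le) n.
have z1M w : rnorm w <= 1 -> z1 w = z1 (trunc M w).
  exact: linf_functional_attaining_trunc z1le (Sle _ x1le) zS r1 Sx1M.
pose y1 : {linear c0 R k -> (scalars R k)^o} := z1 \o @c0_linf R k.
pose S1 : {linear X -> c0 R k} := trunc M \o S \+ (T \- (trunc M \o JT)).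
have y1le w : rnorm w <= 1 -> rnorm (y1 w) <= 1 by move=> w1; exact: z1le.
have S1le x : rnorm x <= 1 -> rnorm (S1 x) <= 1.
  by move=> xle; exact: rnorm_splice_le (Sle _ xle) (Tle _ xle).
have yS1 : rnorm (y1 (S1 x1)) = 1.
  (* [S1 x1] and [S x1] have the same first [M] coordinates, the only ones that [z1] sees. *)
  rewrite -zS (z1M _ (Sle _ x1le)) -(trunc_splice M (S x1) (T x1)).
  congr rnorm; exact: z1M (S1le _ x1le).
exists y1, x1, S1; split => //.
- split; first exact: rnorm_le_continuous y1le.
  by apply: opnorm_eq y1le (S1le _ x1le) _; rewrite yS1.
- split; first by apply/linear_bounded_nearP; exists 1.
  (* A functional of norm at most 1 has modulus 1 at [S1 x1], so [S1] attains its norm at [x1]. *)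
  apply: opnorm_eq S1le x1le _.
  by have := linear_rnorm_le _ _ y1le (S1 x1); rewrite yS1 mul1r.
- have e2e : eps / 2 < eps by rewrite gtr_pMr// invf_lt1// ltr1n.
  split; first exact: lt_trans x1e e2e.
  (* The distance from [y1] to [y0] is estimated through [h]. *)
  + apply: (@le_lt_trans _ _ (opnorm (z1 \- h) + d)); last by rewrite [ltRHS]splitr ltrD.
    apply: opnorm_le => w w1 /=.
    rewrite -(subrK (h w) (z1 w)) -addrA (le_trans (ler_rnormD _ _))//.
    by rewrite lerD ?hy0//; exact: zhle.
  + apply: le_lt_trans (lt_trans Se e2e).
    (* [S1 x - T x] is [S x - T x] cut off after [M] terms. *)
    by apply: opnorm_le => x xle; exact: rnorm_spliceB_le (STle _ xle).
Qed.
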